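(* Suppose $U$ is a semigroup, and $S$ a monoid with a monoidal left action on $U^1$ by semigroup morphisms. Then, with the notation of the context, the semidirect product $U\rtimes S$ has presentation $\operatorname{Sgp}\langle Y:R_1\cup R_2\rangle$ via the morphism $\Phi:Y^+\to U\rtimes S$ determined by $x_s\mapsto(\overline x,s)$ for $x\in X$, $s\in S$, where $$R_1=\{(w_s,v_s):(w,v)\in R,\ s\in S\},\qquad R_2=\{(x_sy_t,\,(xN({}^s\overline y))_{st}):x,y\in X,\ s,t\in S\}.$$
   Context: $U^1=U$ if $U$ is a monoid, and otherwise $U^1=U\sqcup\{1\}$ with an adjoined identity $1$. A left action $(s,u)\mapsto{}^su$ of $S$ on $U^1$ by semigroup morphisms satisfies ${}^s({}^tu)={}^{st}u$ and ${}^s(uv)={}^su\cdot{}^sv$; it is monoidal if ${}^1u=u$ for all $u\in U^1$, where $1$ is the identity of $S$. (It is not assumed that ${}^s1=1$, nor that $U$ is closed under the action.) $U\rtimes S$ is the semigroup $\{(u,s):u\in U,s\in S\}$ with product $(u,s)(v,t)=(u\cdot{}^sv,st)$. $X^+$ is the free semigroup of non-empty words over $X$, $X^*=X^+\cup\{\iota\}$ with $\iota$ the empty word. A semigroup $T$ has presentation $\operatorname{Sgp}\langle X:R\rangle$ via $\phi$ if $\phi:X^+\to T$ is a surjective morphism whose kernel is the congruence $R^\sharp$ on $X^+$ generated by $R\subseteq X^+\times X^+$. Maps are written on the right. It is assumed that $U$ has presentation $\operatorname{Sgp}\langle X:R\rangle$ via $\phi:X^+\to U$, with $\phi|_X$ injective;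 write $\overline w=w\phi$ for $w\in X^+$. $N:U\to X^+$ is a fixed map with $N(u)\phi=u$ for all $u\in U$ and $N(\overline x)=x$ for all $x\in X$. If $1\notin U$, by convention $N(1)=\iota$. $Y=\{x_s:x\in X,\ s\in S\}$ is an alphabet in one-one correspondence with $X\times S$, and $X$ is identified with a subset of $Y$ via $x\equiv x_1$. For a non-empty word $w=x_1\cdots x_k\in X^+$ (with $x_1,\dots,x_k\in X$) and $s\in S$, $w_s=x_1\cdots x_{k-1}(x_k)_s\in Y^+$. (So if ${}^s\overline y=1\notin U$, then $(xN({}^s\overline y))_{st}=x_{st}$.) *)

(* Defs.v *)
From HB Require Import structures.
From mathcomp Require Import all_boot.
From mathcomp Require Import boolp.

Set Implicit Arguments.
Unset Strict Implicit.
Unset Printing Implicit Defensive.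

Import Algebra.
Local Open Scope group_scope.

(* A non-empty word is stored as its first letter and the remaining,
   possibly empty, word; X^* itself is represented by [seq X]. *)
Record word (X : Type) := Word { whead : X; wtail : seq X }.

Definition letter (X : Type) (x : X) : word X := Word x [::].

Definition seq_of_word (X : Type) (w : word X) : seq X := whead w :: wtail w.

Definition word_pair (X : Type) (w : word X) := (whead w, wtail w).
Definition pair_word (X : Type) (p : X * seq X) := Word p.1 p.2.

Lemma word_pairK (X : Type) : cancel (@word_pair X) (@pair_word X).
Proof. by case. Qed.

HB.instance Definition _ (X : choiceType) :=
  Choice.copy (word X) (can_type (@word_pairK X)).

Definition word_mul (X : Type) (w v : word X) : word X :=
  Word (whead w) (wtail w ++ seq_of_word v).

Lemma word_mulA (X : Type) : associative (@word_mul X).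
Proof. by move=> [x u] [y v] [z w]; rewrite /word_mul /= -catA. Qed.

HB.instance Definition _ (X : choiceType) :=
  isSemigroup.Build (word X) (@word_mulA X).

(* The extension of f : X -> T to a morphism X^+ -> T. *)
Definition word_lift (X : choiceType) (T : semigroupType) (f : X -> T)
    (w : word X) : T :=
  foldl (fun t x => t * f x) (f (whead w)) (wtail w).

Lemma word_lift_letter (X : choiceType) (T : semigroupType) (f : X -> T) x :
  word_lift f (letter x) = f x.
Proof. by []. Qed.

Lemma word_liftM (X : choiceType) (T : semigroupType) (f : X -> T) :
  {morph word_lift f : w v / w * v}.
Proof.
move=> [x w] [y v]; rewrite /word_lift /= foldl_cat /=; set t := foldl _ _ w.
by elim: v t (f y) => [|z v IHv] t t' //=; rewrite -IHv mulgA.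
Qed.

HB.instance Definition _ (X : choiceType) (T : semigroupType) (f : X -> T) :=
  isMultiplicative.Build (word X) T (word_lift f) (word_liftM f).

(* The congruence R^# generated by R. *)
Inductive cong_closure (T : magmaType) (R : T -> T -> Prop) : T -> T -> Prop :=
| cong_base a b : R a b -> cong_closure R a b
| cong_refl a : cong_closure R a a
| cong_sym a b : cong_closure R a b -> cong_closure R b a
| cong_trans a b c :
    cong_closure R a b -> cong_closure R b c -> cong_closure R a c
| cong_mul a b c d :
    cong_closure R a b -> cong_closure R c d -> cong_closure R (a * c) (b * d).

(* T has presentation Sgp<X : R> via phi. *)
Definition presentation (X : choiceType) (T : semigroupType)
    (R : word X -> word X -> Prop) (phi : {multiplicative word X -> T}) : Prop :=
  (forall t, exists w, phi w = t) /\
  (forall w v, phi w = phi v <-> cong_closure R w v).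

Definition has_identity (U : magmaType) : Prop :=
  exists e : U, forall u : U, e * u = u /\ u * e = u.

(* U^1: the identity is adjoined only when U is not already a monoid.  The
   side condition is boolean so that it has a unique proof. *)
Variant with_one (U : magmaType) :=
| InU of U
| AdjOne of ~~ `[< has_identity U >].

Definition with_one_option (U : magmaType) (a : with_one U) : option U :=
  if a is InU u then Some u else None.

Definition option_with_one (U : magmaType) (o : option U) :
    option (with_one U) :=
  if o is Some u then Some (InU u)
  else match @idP (~~ `[< has_identity U >]) with
       | ReflectT noid => Some (AdjOne noid)
       | ReflectF _ => None
       end.

Lemma with_one_optionK (U : magmaType) :
  pcancel (@with_one_option U) (@option_with_one U).
Proof.
case=> [//|noid] /=; case: {-}_ / idP => // noid'.
by congr (Some (AdjOne _)); apply: bool_irrelevance.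
Qed.

HB.instance Definition _ (U : semigroupType) :=
  Choice.copy (with_one U) (pcan_type (@with_one_optionK U)).

Definition with_one_mul (U : magmaType) (a b : with_one U) : with_one U :=
  match a, b with
  | InU u, InU v => InU (u * v)
  | InU _, AdjOne _ => a
  | AdjOne _, _ => b
  end.

Lemma with_one_mulA (U : semigroupType) : associative (@with_one_mul U).
Proof. by move=> [u|p] [v|q] [w|r] //=; rewrite mulgA. Qed.

HB.instance Definition _ (U : semigroupType) :=
  isSemigroup.Build (with_one U) (@with_one_mulA U).

(* The product of an element of U and one of U^1, which lies in U. *)
Definition mul_with_one (U : magmaType) (u : U) (a : with_one U) : U :=
  if a is InU v then u * v else u.

Lemma mul_with_oneE (U : semigroupType) (u : U) (a : with_one U) :
  InU (mul_with_one u a) = InU u * a.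
Proof. by case: a. Qed.

Record left_action (S U : semigroupType) := LeftAction {
  act :> S -> {multiplicative with_one U -> with_one U};
  actM : forall s t a, act s (act t a) = act (s * t) a }.

Definition monoidal (S : monoidType) (U : semigroupType)
    (alpha : left_action S U) : Prop :=
  forall a, alpha 1 a = a.

(* The underlying set of the semidirect product of U by S is U x S. *)
Record semidirect (S U : semigroupType) (alpha : left_action S U) :=
  SemiDirect { sd_fst : U; sd_snd : S }.

Definition semidirect_pair (S U : semigroupType) (alpha : left_action S U)
    (p : semidirect alpha) := (sd_fst p, sd_snd p).
Definition pair_semidirect (S U : semigroupType) (alpha : left_action S U)
    (p : U * S) : semidirect alpha := SemiDirect alpha p.1 p.2.

Lemma semidirect_pairK (S U : semigroupType) (alpha : left_action S U) :
  cancel (@semidirect_pair S U alpha) (@pair_semidirect S U alpha).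
Proof. by case. Qed.

HB.instance Definition _ (S U : semigroupType) (alpha : left_action S U) :=
  Choice.copy (semidirect alpha) (can_type (@semidirect_pairK S U alpha)).

Definition semidirect_mul (S U : semigroupType) (alpha : left_action S U)
    (p q : semidirect alpha) : semidirect alpha :=
  SemiDirect alpha (mul_with_one (sd_fst p) (alpha (sd_snd p) (InU (sd_fst q))))
    (sd_snd p * sd_snd q).

Lemma semidirect_mulA (S U : semigroupType) (alpha : left_action S U) :
  associative (@semidirect_mul S U alpha).
Proof.
move=> [u s] [v t] [w r]; rewrite /semidirect_mul /= mulgA; congr SemiDirect.
rewrite mul_with_oneE gmulfM actM.
by case: (alpha s _) (alpha (s * t) _) => [a|p] [b|q] //=; rewrite mulgA.
Qed.

HB.instance Definition _ (S U : semigroupType) (alpha : left_action S U) :=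
  isSemigroup.Build (semidirect alpha) (@semidirect_mulA S U alpha).

(* Y = {x_s} is X * S, with x_s the pair (x, s) and x in X identified with
   (x, 1).  [subscript w s] is w_s: only the last letter of w receives s, the
   others receive 1. *)
Fixpoint subscript_seq (X : choiceType) (S : monoidType) (x : X) (w : seq X)
    (s : S) : word (X * S)%type :=
  if w is y :: w' then letter (x, 1) * subscript_seq y w' s
  else letter (x, s).

Definition subscript (X : choiceType) (S : monoidType) (w : word X) (s : S) :
    word (X * S)%type :=
  subscript_seq (whead w) (wtail w) s.

(* The extension of N : U -> X^+ to U^1 -> X^*, with N(1) the empty word when
   1 is not in U. *)
Definition normal_form1 (X : choiceType) (U : semigroupType) (N : U -> word X)
    (a : with_one U) : seq X :=
  if a is InU u then seq_of_word (N u) else [::].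

Definition rel_R1 (X : choiceType) (S : monoidType)
    (R : word X -> word X -> Prop) (p q : word (X * S)%type) : Prop :=
  exists w v s, [/\ R w v, p = subscript w s & q = subscript v s].

Definition rel_R2 (X : choiceType) (S : monoidType) (U : semigroupType)
    (alpha : left_action S U) (phi : word X -> U) (N : U -> word X)
    (p q : word (X * S)%type) : Prop :=
  exists x y s t,
    p = letter (x, s) * letter (y, t) /\
    q = subscript (Word x (normal_form1 N (alpha s (InU (phi (letter y))))))
          (s * t).

Definition sd_letter (X : choiceType) (S : monoidType) (U : semigroupType)
    (alpha : left_action S U) (phi : word X -> U) (y : X * S) :
    semidirect alpha :=
  SemiDirect alpha (phi (letter y.1)) y.2.

(* Main.v *)
Require Import Defs.
From HB Require Import structures.
From mathcomp Require Import all_boot.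
From mathcomp Require Import boolp.

(** The words [w_s], that is [subscript w s], serve as representatives: the
    words over [X * S] all reduce to this shape, [w] being determined only
    modulo [R].  Since [1] acts trivially, [w_s] is sent to the pair of [phi w] and [s]
    ([sd_lift_subscript]); this gives surjectivity, and shows that both kinds
    of relations hold in the semidirect product.

    Conversely, the second kind of relations moves a subscript inside a word
    to its last letter, so that every word over [X * S] is congruent to some
    [w_s] ([cong_to_subscript]).  If [w_s] and [v_t] have the same image, then
    [s = t] and [phi w = phi v], so that [w] and [v] are congruent modulo [R].
    Finally a derivation of [w] from [v] modulo [R] can be copied between [w_s]
    and [v_s] by the first kind of relations ([cong_subscript]), because
    [(w v)_s = w_1 v_s]. *)

Set Implicit Arguments.
Unset Strict Implicit.
Unset Printing Implicit Defensive.

Import Algebra.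
Local Open Scope group_scope.

Lemma cong_closure_morph (M T : magmaType) (f : M -> T) (R : M -> M -> Prop) :
  {morph f : a b / a * b} -> (forall a b, R a b -> f a = f b) ->
  forall a b, cong_closure R a b -> f a = f b.
Proof.
move=> fM fR a b; elim=> {a b} [a b /fR|a|a b _|a b c _ -> _ ->|a b c d _ fab _ fcd]
  //.
by rewrite !fM fab fcd.
Qed.

Lemma word_rcons_ind (X : choiceType) (P : word X -> Prop) :
  (forall x, P (letter x)) ->
  (forall w x, P w -> P (w * letter x)) ->
  forall w, P w.
Proof.
move=> Pletter Prcons [x w]; elim/last_ind: w => [|w y Pw]; first exact: Pletter.
by rewrite -cats1; apply: (Prcons (Word x w)).
Qed.

Section Subscript.

Variables (X : choiceType) (S : monoidType).

Lemma subscript_cons (x y : X) (w : seq X) (s : S) :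
  subscript (Word x (y :: w)) s = letter (x, 1) * subscript (Word y w) s.
Proof. by []. Qed.

Lemma subscriptM (w v : word X) (s : S) :
  subscript (w * v) s = subscript w 1 * subscript v s.
Proof.
case: w v => x w [z v]; elim: w x => [//|y w IHw] x.
by rewrite [LHS]subscript_cons subscript_cons -mulgA -IHw.
Qed.

(** A derivation modulo [R] is copied step by step.  The induction hypothesis
    has to cover all subscripts: in a product the left factor gets the
    subscript [1] and the right one the subscript [s]. *)
Lemma cong_subscript (R : word X -> word X -> Prop)
    (R' : word (X * S)%type -> word (X * S)%type -> Prop) :
  (forall p q, rel_R1 R p q -> R' p q) ->
  forall w v, cong_closure R w v ->
  forall s, cong_closure R' (subscript w s) (subscript v s).
Proof.
move=> R1R' w v; elim=> {w v} [w v Rwv|w|w v _ IH|u v w _ IH1 _ IH2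
  |w v w' v' _ IH1 _ IH2] s.
- by apply/cong_base/R1R'; exists w, v, s.
- exact: cong_refl.
- exact: cong_sym.
- exact: cong_trans (IH1 s) (IH2 s).
- by rewrite !subscriptM; apply: cong_mul.
Qed.

End Subscript.

Section SemidirectWords.

Variables (U : semigroupType) (S : monoidType) (alpha : left_action S U).
Variables (X : choiceType) (phi : {multiplicative word X -> U}).
Variable N : U -> word X.

Lemma sd_lift_subscript : monoidal alpha -> forall w s,
  word_lift (sd_letter alpha phi) (subscript w s) = SemiDirect alpha (phi w) s.
Proof.
move=> alpha1 [x w] s; elim: w x => [//|y w IHw] x.
rewrite subscript_cons word_liftM IHw word_lift_letter.
rewrite -[Word x _]/(letter x * Word y w) gmulfM.
by rewrite /mul/= /semidirect_mul /= alpha1 mul1g.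
Qed.

Lemma phi_mul_normal_form1 : (forall u, phi (N u) = u) -> forall x a,
  phi (Word x (normal_form1 N a)) = mul_with_one (phi (letter x)) a.
Proof.
move=> N_phi x [u|//] /=; rewrite -[in RHS](N_phi u) -gmulfM.
by congr (phi _).
Qed.

(** The relations of the second kind are exactly the case of a one-letter word
    [w]; the letters before the last one only go along, as they have the
    subscript [1] on both sides. *)
Lemma cong_subscript_mul_letter
    (R' : word (X * S)%type -> word (X * S)%type -> Prop) :
  (forall p q, rel_R2 alpha phi N p q -> R' p q) ->
  forall w s y t, exists v,
  cong_closure R' (subscript w s * letter (y, t)) (subscript v (s * t)).
Proof.
move=> R2R' [x w] s y t.
exists (Word x (w ++ normal_form1 N (alpha s (InU (phi (letter y)))))).
elim: w x => [|z w IHw] x.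
  by apply/cong_base/R2R'; exists x, y, s, t.
rewrite cat_cons !subscript_cons -mulgA.
exact: cong_mul (cong_refl _ _) (IHw z).
Qed.

(** By induction, the subscript that has been collected on the last letter is
    pushed onto each new letter appended on the right. *)
Lemma cong_to_subscript
    (R' : word (X * S)%type -> word (X * S)%type -> Prop) :
  (forall p q, rel_R2 alpha phi N p q -> R' p q) ->
  forall p, exists w s, cong_closure R' p (subscript w s).
Proof.
move=> R2R'; elim/word_rcons_ind=> [[x s]|p [y t] [w [s pw]]].
  by exists (letter x), s; apply: cong_refl.
have [v wv] := cong_subscript_mul_letter R2R' w s y t.
exists v, (s * t); apply: cong_trans wv.
exact: cong_mul pw (cong_refl _ _).
Qed.

End SemidirectWords.

Theorem theorem6p50 (U : semigroupType) (S : monoidType)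
    (alpha : left_action S U) (alpha_monoidal : monoidal alpha)
    (X : choiceType) (R : word X -> word X -> Prop)
    (phi : {multiplicative word X -> U})
    (phi_pres : presentation R phi)
    (phi_inj : injective (fun x : X => phi (letter x)))
    (N : U -> word X)
    (N_phi : forall u : U, phi (N u) = u)
    (N_letter : forall x : X, N (phi (letter x)) = letter x) :
  presentation
    (fun p q : word (X * S)%type => rel_R1 R p q \/ rel_R2 alpha phi N p q)
    (word_lift (sd_letter alpha phi)).
Proof.
have [phi_surj phi_ker] := phi_pres; set R' := fun p q => _ \/ _.
have lift_sub := sd_lift_subscript phi alpha_monoidal.
have sound : forall p q, cong_closure R' p q ->
    word_lift (sd_letter alpha phi) p = word_lift (sd_letter alpha phi) q.
  apply: (cong_closure_morph (word_liftM _)) => p q.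
  case=> [[w [v [s [Rwv -> ->]]]]|[x [y [s [t [-> ->]]]]]].
    by rewrite !lift_sub; congr SemiDirect; apply/phi_ker/cong_base.
  by rewrite lift_sub phi_mul_normal_form1.
split=> [[u s]|p q].
  by have [w <-] := phi_surj u; exists (subscript w s); apply: lift_sub.
split=> [|/sound //] eq_pq.
have R2R' : forall p q, rel_R2 alpha phi N p q -> R' p q by right.
have [w [s pw]] := cong_to_subscript R2R' p.
have [v [t qv]] := cong_to_subscript R2R' q.
have := eq_pq; rewrite /= (sound _ _ pw) (sound _ _ qv) !lift_sub => -[eq_wv eq_st].
apply: (cong_trans pw); apply: cong_trans (cong_sym qv); rewrite eq_st.
by apply: (cong_subscript (R := R)) => [*|]; [left | apply/phi_ker].
Qed.
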